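(* Let $A$ be a coherently continuous dcpo with a countable basis $K$. Then for any $x\in A$, the set $I_x=\{y\in A\mid\{x,y\}\text{ has no upper bound in }A\}$ is Scott open.
   Context: Directed sets are nonempty. A dcpo is a poset with least element in which every directed subset has a least upper bound. $x\ll y$ means: for every directed $S$ with $y\sqsubseteq\sqcup S$ there is $s\in S$ with $x\sqsubseteq s$. A dcpo $A$ is continuous with basis $K\subseteq A$ if for every $a\in A$ the set $\{k\in K\mid k\ll a\}$ is directed with supremum $a$. $U\subseteq A$ is Scott open if it is upward closed and meets every directed $S$ with $\sqcup S\in U$. A continuous dcpo $A$ with basis $K$ is coherently continuous if for any $k,k'\in K$ the set $\mathrm{MUB}(k,k')$ of minimal upper bounds (in $A$) of $\{k,k'\}$ is finite, and for any $x\in A$ with $k\sqsubseteq x$ and $k'\sqsubseteq x$ there is $k''\in\mathrm{MUB}(k,k')$ with $k''\sqsubseteq x$. *)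

(* Defs.v *)
From mathcomp Require Export all_boot all_order.
From mathcomp Require Export boolp classical_sets cardinality.

Set Implicit Arguments.
Unset Strict Implicit.
Unset Printing Implicit Defensive.

Local Open Scope classical_set_scope.
Local Open Scope order_scope.

Section Domains.
Context {d : Order.disp_t} {A : porderType d}.
Implicit Types (K S U : set A) (x y : A).

Definition directed S : Prop :=
  S !=set0 /\
  forall x y, S x -> S y -> exists z, [/\ S z, x <= z & y <= z].

(* The join of a directed set occurs here, and in [scott_open], as any [m] with
   [isLub S m]; such an [m] is unique by antisymmetry and exists in a dcpo. *)
Definition way_below x y : Prop :=
  forall S m, directed S -> isLub S m -> y <= m ->
  exists2 s, S s & x <= s.

Definition continuous_basis K : Prop :=
  forall a,
    directed [set k | K k /\ way_below k a] /\
    isLub [set k | K k /\ way_below k a] a.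

Definition scott_open U : Prop :=
  (forall x y, U x -> x <= y -> U y) /\
  (forall S m, directed S -> isLub S m -> U m -> U `&` S !=set0).

Definition MUB x y : set A :=
  [set m | ubound [set x; y] m /\
           forall m', ubound [set x; y] m' -> m' <= m -> m' = m].

Definition inconsistent_with x : set A :=
  [set y | ~ has_ubound [set x; y]].

End Domains.

(* The least element required of a dcpo is supplied by [bPOrderType]. *)
Definition is_dcpo {d : Order.disp_t} (A : bPOrderType d) : Prop :=
  forall S : set A, directed S -> exists m, isLub S m.

Definition coherently_continuous {d : Order.disp_t} (A : bPOrderType d)
    (K : set A) : Prop :=
  [/\ is_dcpo A,
      continuous_basis K
    & forall k k', K k -> K k' ->
        finite_set (MUB k k') /\
        forall x, k <= x -> k' <= x ->
          exists2 k'', MUB k k' k'' & k'' <= x].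

(* Main.v *)
Require Import Defs.

(** Choose increasing sequences [k n] and [l n] of basis elements with suprema
    [x] and [m], where [m] is the supremum of a directed set [S] all of whose
    elements are consistent with [x].  Each [l n] is below some element of [S],
    so the finite set [MUB (k n) (l n)] is nonempty, and each element of
    [MUB (k n.+1) (l n.+1)] lies above one of [MUB (k n) (l n)].  By Koenig's
    lemma there is an increasing sequence [u n] in [MUB (k n) (l n)]; its
    supremum bounds both [x] and [m]. *)

Set Implicit Arguments.
Unset Strict Implicit.
Unset Printing Implicit Defensive.

Import Order.POrderTheory.
Local Open Scope classical_set_scope.
Local Open Scope order_scope.

Lemma graded_dependent_choice (T : Type) (P : nat -> set T) (R : T -> T -> Prop) :
    P 0 !=set0 ->
    (forall n x, P n x -> exists2 y, P n.+1 y & R x y) ->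
  exists f : nat -> T, forall n, P n (f n) /\ R (f n) (f n.+1).
Proof.
move=> [x0 Px0] step.
(* The stage is paired with the point because the successor depends on both. Where [P] fails the
   requirement is vacuous, and the point itself serves as the value. *)
have [g gP] : {g : nat * T -> T & forall nx,
    P nx.1 nx.2 -> P nx.1.+1 (g nx) /\ R nx.2 (g nx)}.
  apply: (@choice _ _ (fun nx y =>
    P nx.1 nx.2 -> P nx.1.+1 y /\ R nx.2 y)) => -[n x] /=.
  have [Px|nPx] := pselect (P n x); last by exists x.
  by have [y] := step n x Px; exists y.
pose f := nat_rect (fun=> T) x0 (fun n x => g (n, x)).
have Pf n : P n (f n) by elim: n => //= n /(gP (n, _))[].
by exists f => n; split=> //; case: (gP (n, f n) (Pf n)).
Qed.

(** If every [v] in [F] dropped out at some stage [b v], then, the sets being decreasing, none would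
    be left at the largest of these finitely many stages. *)
Lemma finite_decreasing_inhabited (T : Type) (F : set T) (P : nat -> set T) :
    finite_set F ->
    (forall j, P j.+1 `<=` P j) ->
    (forall j, exists2 v, F v & P j v) ->
  exists2 v, F v & forall j, P j v.
Proof.
move=> finF decP inhP.
have monoP i j : (i <= j)%N -> P j `<=` P i.
  elim: j => [|j IH]; first by rewrite leqn0 => /eqP ->.
  by rewrite leq_eqVlt ltnS => /orP[/eqP->//|/IH ij v /decP/ij].
apply: contrapT => noV.
have [b bP] : {b : T -> nat & forall v, F v -> ~ P (b v) v}.
  apply: (@choice _ _ (fun v j => F v -> ~ P j v)) => v.
  have [Fv|] := pselect (F v); last by exists 0%N.
  apply: contrapT => nP; apply: noV; exists v => // j.
  by apply: contrapT => nPj; apply: nP; exists j.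
have [N ltN] : exists N, forall v, F v -> (b v <= N)%N.
  have /finite_seqP[s bF] : finite_set (b @` F) by exact: finite_image.
  exists (\max_(i <- s) i)%N => v Fv.
  have bs : b v \in s by have : (b @` F) (b v) by [exists v]; rewrite bF.
  exact: (@leq_bigmax_seq _ _ _ id).
by have [v Fv /(monoP _ _ (ltN v Fv))] := inhP N; apply: bP.
Qed.

(** Predecessors extend paths backwards only, so a careless forward choice may reach a dead end.
    Nodes that start arbitrarily long paths avoid this: as the next level is finite, one of the
    successors is again such a node. *)
Lemma koenig (T : Type) (M : nat -> set T) (R : T -> T -> Prop) :
    (forall n, finite_set (M n)) ->
    (forall n, M n !=set0) ->
    (forall n v, M n.+1 v -> exists2 u, M n u & R u v) ->
  exists f : nat -> T, forall n, M n (f n) /\ R (f n) (f n.+1).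
Proof.
move=> finM inhM pred.
(* [ext j n u]: some [R]-path through [M n], ..., [M (n + j)] starts at [u]. *)
pose fix ext (j n : nat) (u : T) {struct j} : Prop :=
  M n u /\ if j is j'.+1 then exists2 v, ext j' n.+1 v & R u v else True.
have extM j n u : ext j n u -> M n u by case: j => [|j] [].
have ext_dec j n : ext j.+1 n `<=` ext j n.
  elim: j n => [|j IH] n u [Mu [v extv Ruv]] //.
  by split=> //; exists v => //; apply: IH.
have ext_inh j n : exists2 u, M n u & ext j n u.
  elim: j n => [|j IH] n; first by have [u] := inhM n; exists u.
  have [v Mv extv] := IH n.+1; have [u Mu Ruv] := pred n v Mv.
  by exists u => //; split=> //; exists v.
have [||f fP] := @graded_dependent_choice _ (fun n u => forall j, ext j n u) R.
- have [v _ extv] := finite_decreasing_inhabited (finM 0%N)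
    (ext_dec^~ 0%N) (ext_inh^~ 0%N).
  by exists v.
- move=> n u extu.
  (* The edge [R u v] is part of the decreasing predicate, so that the node found for all [j] at
     once is a successor of [u]. *)
  have [|j|v _ Pv] := @finite_decreasing_inhabited _ (M n.+1)
    (fun j v => ext j n.+1 v /\ R u v) (finM _).
  + by move=> j v [/ext_dec].
  (* Removing the first edge of a path with [j.+1] edges leaves one with [j] edges that starts at a
     successor of [u]. *)
  + have [_ [v extv Ruv]] := extu j.+1.
    by exists v; [exact: extM extv | split].
  + by exists v; [move=> j; case: (Pv j) | case: (Pv 0%N)].
by exists f => n; have [/(_ 0%N)/extM] := fP n.
Qed.

Section Directed.
Context {d : Order.disp_t} {A : porderType d}.
Implicit Types (D K S : set A) (f : nat -> A) (x m : A).

(** With [D] numbered by an injection [r], directedness lets stage [n] dominate both the previous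
    stage and the element numbered [n]; hence [x] is dominated at stage [r x]. *)
Lemma countable_directed_cofinal D : countable D -> directed D ->
  exists f, [/\ forall n, D (f n), forall n, f n <= f n.+1
              & forall x, D x -> exists n, x <= f n].
Proof.
move=> /countable_injP[r rinj] [[x0 Dx0] dirD].
have rank n : exists2 w, D w & forall v, D v -> r v = n -> v <= w.
  have [[w [Dw <-]]|none] := pselect (exists w, D w /\ r w = n).
    by exists w => // v Dv /rinj -> //; rewrite inE.
  (* The numbering may skip [n]; any element of [D] then serves. *)
  by exists x0 => // v Dv rv; case: none; exists v.
have [||f fP] := @graded_dependent_choice A
  (fun n u => D u /\ forall v, D v -> r v = n -> v <= u) (fun u v => u <= v).
- by have [w] := rank 0%N; exists w.
- move=> n u [Du _]; have [w Dw wP] := rank n.+1.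
  have [z [Dz uz wz]] := dirD u w Du Dw.
  by exists z => //; split=> // v Dv rv; apply: le_trans (wP v Dv rv) wz.
exists f; split=> [n|n|x Dx]; try by case: (fP n) => -[].
by exists (r x); have [[_ +] _] := fP (r x); apply.
Qed.

Lemma directed_range f : (forall n, f n <= f n.+1) -> directed (range f).
Proof.
move=> incf; split; first by exists (f 0%N), 0%N.
have mono i j : (i <= j)%N -> f i <= f j.
  exact: (homo_leq (@lexx _ _) (@le_trans _ _)) incf i j.
move=> _ _ [i _ <-] [j _ <-]; exists (f (maxn i j)); split.
- by exists (maxn i j).
- by apply: mono; rewrite leq_maxl.
- by apply: mono; rewrite leq_maxr.
Qed.

(** A cofinal chain in the countable directed set of basis elements way below [x] has the same
    supremum as that set. *)
Lemma basis_chain K x : continuous_basis K -> countable K ->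
  exists f, [/\ forall n, K (f n), forall n, way_below (f n) x,
    forall n, f n <= f n.+1 & isLub (range f) x].
Proof.
move=> basisK cntK; have [dirx [ubx lubx]] := basisK x.
have cntx : countable [set k | K k /\ way_below k x].
  by apply: sub_countable cntK; apply: subset_card_le => k [].
have [f [fP incf coff]] := countable_directed_cofinal cntx dirx.
exists f; split=> // [n|n|]; try by case: (fP n).
split=> [_ [n _ <-]|b ub]; first exact/ubx/fP.
apply: lubx => k /coff[n kn]; apply: le_trans kn _.
by apply: ub; exists n.
Qed.

Lemma has_ubound2P x y : has_ubound [set x; y] <-> exists z, x <= z /\ y <= z.
Proof.
split=> [[z ub]|[z [xz yz]]]; first by exists z; split; apply: ub; [left|right].
by exists z => _ [->|->].
Qed.

End Directed.

Lemma consistent_sup (d : Order.disp_t) (A : bPOrderType d) (K S : set A)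
    (x m : A) :
    coherently_continuous K -> countable K -> directed S -> isLub S m ->
    (forall s, S s -> has_ubound [set x; s]) ->
  has_ubound [set x; m].
Proof.
move=> [dcpoA basisK cohK] cntK dirS lubS conS.
have [k [Kk kx inck [_ lubk]]] := basis_chain x basisK cntK.
have [l [Kl lm incl [_ lubl]]] := basis_chain m basisK cntK.
have finM n : finite_set (MUB (k n) (l n)) by case: (cohK _ _ (Kk n) (Kl n)).
have belowM n z : k n <= z -> l n <= z ->
    exists2 u, MUB (k n) (l n) u & u <= z.
  by have [_] := cohK _ _ (Kk n) (Kl n); apply.
have MP n u : MUB (k n) (l n) u -> k n <= u /\ l n <= u.
  by case=> ub _; split; apply: ub; [left|right].
have kle n : k n <= x.
  have [_ [ubx _]] := basisK x; exact: ubx.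
have inhM n : MUB (k n) (l n) !=set0.
  (* [way_below (l n) m] is tested on [S] itself; an upper bound of [x] and the resulting [s] then
     bounds [k n] and [l n]. *)
  have [s Ss ls] := lm n S m dirS lubS (lexx m).
  have /has_ubound2P[z [xz sz]] := conS s Ss.
  have [u Mu _] := belowM n z (le_trans (kle n) xz) (le_trans ls sz).
  by exists u.
have predM n v : MUB (k n.+1) (l n.+1) v ->
    exists2 u, MUB (k n) (l n) u & u <= v.
  move=> /MP[kv lv].
  by apply: belowM; [apply: le_trans (inck n) kv | apply: le_trans (incl n) lv].
have [u uP] := koenig finM inhM predM.
have [z [ubz _]] : exists z, isLub (range u) z.
  by apply/dcpoA/directed_range => n; case: (uP n).
have uz n : u n <= z by apply: ubz; exists n.
apply/has_ubound2P; exists z; split.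
- apply: lubk => _ [n _ <-]; have [/MP[ku _] _] := uP n.
  exact: le_trans ku (uz n).
- apply: lubl => _ [n _ <-]; have [/MP[_ lu] _] := uP n.
  exact: le_trans lu (uz n).
Qed.

Theorem theorem12p3p1 (d : Order.disp_t) (A : bPOrderType d) (K : set A)
    (hA : coherently_continuous K) (hK : countable K) (x : A) :
  scott_open (inconsistent_with x).
Proof.
split=> [y z incy yz /has_ubound2P[w [xw zw]]|S m dirS lubS incm].
  by apply/incy/has_ubound2P; exists w; split=> //; apply: le_trans zw.
(* By contraposition: if [S] misses the inconsistent elements, each of its members is consistent
   with [x], and hence so is [m]. *)
apply: contrapT => disj; apply: incm; apply: consistent_sup hA hK dirS lubS _.
by move=> s Ss; apply: contrapT => incs; apply: disj; exists s.
Qed.
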